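(* Assume that $\mathcal{G}\in\mathcal{G}_k$ (that is, $\mathcal{G}$ is a good $k$-uniform hypergraph) and that $\mathcal{H}$ is a $k$-uniform hypergraph with a vertex such that the hypergraph induced by the edges containing this vertex is a star. Then for sufficiently large $n$, $$R(\mathcal{G},n\mathcal{H})=|V(\mathcal{G})|+n|V(\mathcal{H})|-\alpha(\mathcal{G})-1.$$
   Context: A $k$-uniform hypergraph $\mathcal{H}$ is a pair $(V,E)$ where $V$ is a set of vertices and $E$ is a set of $k$-subsets of $V$ (the edges). $n\mathcal{H}$ denotes $n$ disjoint copies of $\mathcal{H}$. For $k$-uniform hypergraphs $\mathcal{G},\mathcal{H}$, the Ramsey number $R(\mathcal{G},\mathcal{H})$ is the smallest positive integer $N$ such that every red-blue coloring of the edges of the complete $k$-uniform hypergraph on $N$ vertices contains a red copy of $\mathcal{G}$ or a blue copy of $\mathcal{H}$. A set $S$ of vertices is independent if no edge is contained in $S$; $\alpha(\mathcal{G})$ is the maximum size of an independent set. A strong independent set of a $k$-uniform hypergraph is an independent set $S$ of vertices such that every edge has exactly one vertex outside $S$. $\mathcal{F}_k$ is the set of all $k$-uniform hypergraphs having a strong independent set; for $\mathcal{G}\in\mathcal{F}_k$, $\alpha^\star(\mathcal{G})$ is the maximum size of a strong independent set. A hypergraph $\mathcal{G}\in\mathcal{F}_k$ is called good if $\alpha^\star(\mathcal{G})=\alpha(\mathcal{G})$, and $\mathcal{G}_k$ denotes the set of all good $k$-uniform hypergraphs. For a set $F$ of edges, the hypergraph induced by $F$ has vertex set $\bigcup_{e\in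 F}e$ and edge set $F$. A star $\mathcal{S}^k_d$ is the $k$-uniform hypergraph with vertex set $\{v,v_1,\dots,v_{d(k-1)}\}$ and $d$ edges $\{v\}\cup\{v_{i(k-1)+1},\dots,v_{i(k-1)+k-1}\}$, $i=0,\dots,d-1$; that is, its $d$ edges all contain $v$ and are otherwise pairwise disjoint.
   Formalization: The theorem additionally assumes that G has at least one edge and that H has no isolated vertices; the formula fails for edgeless G, and, for example, for k = 2, G = C4 and H = an edge plus an isolated vertex, where R(G,nH) is at most 3n, not 3n+1. *)

(* Defs.v *)
From HB Require Import structures.
From mathcomp Require Import all_boot.

Set Implicit Arguments.
Unset Strict Implicit.
Unset Printing Implicit Defensive.

Record hypergraph := Hypergraph {
  vertex :> finType;
  edges : {set {set vertex}}
}.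

Definition uniform (k : nat) (G : hypergraph) : Prop :=
  forall e : {set G}, e \in edges G -> #|e| = k.

Definition iso (G H : hypergraph) : Prop :=
  exists2 f : G -> H, bijective f &
    forall e : {set G}, (f @: e \in edges H) = (e \in edges G).

(* [F] has a (not necessarily induced) subhypergraph isomorphic to [G]. *)
Definition contains (F G : hypergraph) : Prop :=
  exists2 f : G -> F, injective f &
    forall e : {set G}, e \in edges G -> f @: e \in edges F.

Definition copies (n : nat) (H : hypergraph) : hypergraph :=
  @Hypergraph ('I_n * H)%type
    [set [set (i, x) | x in e] | i : 'I_n in [set: 'I_n], e : {set H} in edges H].

Definition monochromatic (k N : nat) (c : {set 'I_N} -> bool) (b : bool) :
  hypergraph := @Hypergraph 'I_N [set e : {set 'I_N} | (#|e| == k) && (c e == b)].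

(* A colouring is given on all subsets of ['I_N], but only its values on
   [k]-subsets matter; [true] is red and [false] is blue. *)
Definition arrows (k N : nat) (G H : hypergraph) : Prop :=
  forall c : {set 'I_N} -> bool,
    contains (monochromatic k c true) G \/ contains (monochromatic k c false) H.

(* [R(G, H) = N] *)
Definition is_ramsey_number (k : nat) (G H : hypergraph) (N : nat) : Prop :=
  [/\ 0 < N, arrows k N G H &
      forall M : nat, 0 < M -> arrows k M G H -> N <= M].

Definition independent (G : hypergraph) (S : {set G}) : bool :=
  [forall e in edges G, ~~ (e \subset S)].

Definition strong_independent (G : hypergraph) (S : {set G}) : bool :=
  independent S && [forall e in edges G, #|e :\: S| == 1].

Definition alpha (G : hypergraph) : nat :=
  \max_(S : {set G} | independent S) #|S|.

Definition alpha_star (G : hypergraph) : nat :=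
  \max_(S : {set G} | strong_independent S) #|S|.

Definition good (k : nat) (G : hypergraph) : Prop :=
  [/\ uniform k G,
      exists S : {set G}, strong_independent S &
      alpha_star G = alpha G].

Definition induced (G : hypergraph) (F : {set {set G}}) : hypergraph :=
  @Hypergraph {x : G | x \in cover F}
    [set e : {set {x : G | x \in cover F}} | [set val x | x in e] \in F].

(* [None] is the centre; [Some (i, j)] is the [j]-th of the [k - 1] other
   vertices of the [i]-th edge. Meaningful for [0 < k]. *)
Definition star (k d : nat) : hypergraph :=
  @Hypergraph (option ('I_d * 'I_k.-1))
    [set None |: [set Some (i, j) | j in [set: 'I_k.-1]] | i in [set: 'I_d]].

(* No vertex of degree zero satisfies this: the hypergraph induced by the empty
   set of edges has no vertex, whereas [star k 0] has one. *)
Definition star_vertex (k : nat) (H : hypergraph) (v : H) : Prop :=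
  exists d : nat, iso (induced [set e : {set H} in edges H | v \in e]) (star k d).

Definition no_isolated_vertex (H : hypergraph) : Prop :=
  forall x : H, exists2 e : {set H}, e \in edges H & x \in e.

(* Main.v *)
Require Import Defs.
From mathcomp Require Import all_boot zify.

(** Let [t = |G| - alpha G] and [h = |H|], so that the claimed value is
    [n h + t - 1]. Lower bound: make blue exactly the edges inside a set of
    [n h - 1] vertices; the part of a red [G] inside this set would be
    independent, and larger than [alpha G].

    Upper bound: assume there is no red [G]. By Ramsey's theorem there is a huge
    blue clique [Q]; from the other vertices, remove disjoint blue copies of [H]
    as long as Ramsey's theorem provides them, leaving a set [L] of bounded
    size. If the link of [v] in [Q] contains enough disjoint blue
    [(k-1)]-sets, then [v] as star vertex and [h - 1] vertices of [Q] form a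
    blue [H]; otherwise, the link is red on [Q] minus at most [h] vertices. The
    latter cannot happen for [t] vertices [v] at once: they would yield a red
    [G], with a strong independent set of size [alpha G] placed in [Q]. So [L]
    can be reduced below [t] vertices, and what remains of [Q] is then cut into
    copies of [H], wasting fewer than [h] vertices. *)

(** * Homogeneous sets and Ramsey's theorem *)

Definition homogeneous {V : finType} (k : nat) (c : {set V} -> bool) (b : bool)
    (B : {set V}) : Prop :=
  forall e : {set V}, e \subset B -> #|e| = k -> c e = b.

Lemma homogeneousS {V : finType} k (c : {set V} -> bool) b (A B : {set V}) :
  A \subset B -> homogeneous k c b B -> homogeneous k c b A.
Proof. by move=> sAB hB e eA; apply: hB; apply: subset_trans sAB. Qed.

Lemma homogeneousU1 {V : finType} k (c : {set V} -> bool) b x (B : {set V}) :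
  homogeneous k (fun e => c (x |: e)) b B -> homogeneous k.+1 c b B ->
  homogeneous k.+1 c b (x |: B).
Proof.
move=> hx hB e sub ek; have [xe|xe] := boolP (x \in e).
  rewrite -(setD1K xe); apply: hx; first by rewrite subDset.
  by move: (cardsD1 x e); rewrite xe ek => -[].
apply: hB => //; apply/subsetP=> y ye.
by have := subsetP sub y ye; rewrite !inE (negPf (memPn xe y ye)).
Qed.

Lemma exists_subset_card {V : finType} (A : {set V}) m :
  m <= #|A| -> exists2 B : {set V}, B \subset A & #|B| = m.
Proof.
move=> le; exists [set x in take m (enum A)].
  by apply/subsetP=> x; rewrite inE => /mem_take; rewrite mem_enum.
have /card_uniqP : uniq (take m (enum A)) by rewrite take_uniq ?enum_uniq.
by rewrite cardsE => ->; rewrite size_takel // -cardE.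
Qed.

(** Induction on [k], then on [p] and [q]: fix a vertex [x], apply the case [k] to the colouring of
    the link of [x], with the sizes [rp] and [rq] required by the two smaller cases for [k.+1], and
    add [x] to the set found there if its colour is that of the link. *)
Lemma ramsey k p q : exists r : nat,
  forall (V : finType) (A : {set V}) (c : {set V} -> bool), r <= #|A| ->
  (exists2 B : {set V}, B \subset A /\ #|B| = p & homogeneous k c true B) \/
  (exists2 B : {set V}, B \subset A /\ #|B| = q & homogeneous k c false B).
Proof.
elim: k p q => [|k IHk] p q.
  exists (maxn p q) => V A c; rewrite geq_max => /andP[lep leq].
  (* The empty set is the only edge of size 0, so every set is homogeneous in its colour. *)
  have hom (B : {set V}) : homogeneous 0 c (c set0) B.
    by move=> e _ /eqP; rewrite cards_eq0 => /eqP->.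
  case E: (c set0) hom => hom; [left|right].
    by have [B] := exists_subset_card A p lep; exists B.
  by have [B] := exists_subset_card A q leq; exists B.
have hom0 (V : finType) (c : {set V} -> bool) b : homogeneous k.+1 c b set0.
  by move=> e; rewrite subset0 => /eqP->; rewrite cards0.
elim: p q => [|p IHp] q.
  by exists 0 => V A c _; left; exists set0; rewrite ?sub0set ?cards0.
elim: q => [|q [rq Hq]].
  by exists 0 => V A c _; right; exists set0; rewrite ?sub0set ?cards0.
have [rp Hp] := IHp q.+1; have [r Hr] := IHk rp rq.
exists r.+1 => V A c lerA.
have /card_gt0P[x xA] : 0 < #|A| by apply: leq_trans lerA.
have ler : r <= #|A :\ x| by move: lerA; rewrite (cardsD1 x) xA.
have extend (B C : {set V}) b m : B \subset A :\ x -> C \subset B -> #|C| = m ->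
    homogeneous k (fun e => c (x |: e)) b B -> homogeneous k.+1 c b C ->
    exists2 D : {set V}, D \subset A /\ #|D| = m.+1 & homogeneous k.+1 c b D.
  move=> sBA sCB cC hB hC; have /subsetD1P[sCA xC] := subset_trans sCB sBA.
  exists (x |: C); first by rewrite cardsU1 xC cC subUset sub1set xA.
  exact: homogeneousU1 (homogeneousS _ _ _ _ _ sCB hB) hC.
have sub (B C : {set V}) : B \subset A :\ x -> C \subset B -> C \subset A.
  by move=> sBA sCB; apply: subset_trans (subset_trans sCB sBA) (subsetDl _ _).
have [[B [sBA cB] hB]|[B [sBA cB] hB]] := Hr V (A :\ x) (fun e => c (x |: e)) ler.
  have [[C [sCB cC] hC]|[C [sCB cC] hC]] := Hp V B c ltac:(by rewrite cB).
    by left; apply: (extend B C).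
  by right; exists C => //; split=> //; apply: sub sCB.
have [[C [sCB cC] hC]|[C [sCB cC] hC]] := Hq V B c ltac:(by rewrite cB).
  by left; exists C => //; split=> //; apply: sub sCB.
by right; apply: (extend B C).
Qed.

(** * Greedy embeddings *)

Lemma redefine_injectively {A B : finType} (f : A -> B) (X : {set A}) (Y : {set B}) :
  #|X| <= #|Y| ->
  exists g : A -> B, [/\ {in X &, injective g}, {in X, forall x, g x \in Y} &
    forall x, x \notin X -> g x = f x].
Proof.
move=> le.
pose g x := if x \in X then nth (f x) (enum Y) (index x (enum X)) else f x.
have idx x : x \in X -> index x (enum X) < size (enum Y).
  by move=> xX; rewrite -cardE (leq_trans _ le) // cardE index_mem mem_enum.
exists g; split=> [x y xX yX|x xX|x /negPf xX]; rewrite /g ?xX ?yX //.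
  (* The defaults [f x] and [f y] must agree before uniqueness of [enum Y] applies. *)
  rewrite (set_nth_default (f y)) ?idx // => /eqP.
  rewrite nth_uniq ?idx ?enum_uniq // => /eqP E.
  by rewrite -[x](@nth_index _ x _ (enum X)) ?mem_enum // E nth_index ?mem_enum.
by rewrite -mem_enum mem_nth ?idx.
Qed.

(** Greedy choice: each set of [s] in turn is sent onto a set of colour [b] in [Q] that avoids the
    images so far. If there is none, [Q] minus these at most [#|W|] image points is homogeneous in
    the other colour. *)
Lemma disjoint_family_embedding {W V : finType} l (c : {set V} -> bool) b
    (Q : {set V}) (f0 : W -> V) (s : seq {set W}) :
  {in s, forall a : {set W}, #|a| = l} ->
  pairwise (fun a a' : {set W} => [disjoint a & a']) s ->
  (exists f : W -> V, let X := \bigcup_(a <- s) a in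
    [/\ {in X &, injective f}, {in X, forall x, f x \in Q} &
        {in s, forall a : {set W}, c (f @: a) = b}]) \/
  (exists2 Q' : {set V}, Q' \subset Q /\ #|Q| <= #|Q'| + #|W| &
    homogeneous l c (~~ b) Q').
Proof.
elim: s => [|a s IH] cs.
  by move=> _; left; exists f0; split=> x //; rewrite big_nil inE.
rewrite pairwise_cons => /andP[/allP das ds].
case: IH => // [x xs||]; [by apply: cs; rewrite inE xs orbT| |by right].
move=> [f]; set X := \bigcup_(a <- s) a => -[injf fQ fc].
have leX : #|f @: X| <= #|W| by apply: leq_trans (leq_imset_card _ _) (max_card _).
have [/existsP[e /and3P[]]|/existsPn noe] := boolP
  [exists e : {set V}, [&& e \subset Q :\: f @: X, #|e| == l & c e == b]]; last first.
  right; exists (Q :\: f @: X).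
    by rewrite subsetDl; split=> //; have := cardsID (f @: X) Q;
       have := subset_leq_card (subsetIr Q (f @: X)); lia.
  move=> e sub /eqP ek; move: (noe e); rewrite sub ek /=; case: (c e); by case: b {fc noe}.
move=> /subsetP eQ /eqP el /eqP ce.
have al : #|a| = l by apply: cs; rewrite mem_head.
have [g [injg ge gf]] := redefine_injectively f a e ltac:(by rewrite al el).
(* Since [a] misses [X], redefining [f] on [a] keeps the images of the sets already embedded. *)
have dis x : x \in X -> x \notin a.
  rewrite /X big_tnth => /bigcupP[i _ xi]; apply/negP=> xa.
  by have /pred0P/(_ x) := das _ (mem_tnth i (in_tuple s)); rewrite /= xa xi.
have gX x : x \in X -> g x = f x by move/dis/gf.
left; exists g => /=; rewrite big_cons -/X; split.
- move=> x y; rewrite !inE => /orP[xa|xX] /orP[ya|yX].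
  + exact: injg.
  + rewrite (gX y) // => E; have := eQ _ (ge x xa).
    by rewrite E inE imset_f.
  + rewrite (gX x) // => E; have := eQ _ (ge y ya).
    by rewrite -E inE imset_f.
  + by rewrite !gX //; apply: injf.
- move=> x; rewrite inE => /orP[xa|xX]; last by rewrite gX // fQ.
  by have := eQ _ (ge x xa); rewrite inE => /andP[].
- move=> a'; rewrite inE => /predU1P[->|a's].
    suff -> : g @: a = e by [].
    apply/eqP; rewrite eqEcard card_in_imset // al el leqnn andbT.
    by apply/subsetP=> _ /imsetP[x xa ->]; apply: ge.
  rewrite -(fc a') //; congr c; apply: eq_in_imset => x xa'; apply: gX.
  by rewrite /X (big_rem a') //= inE xa'.
Qed.

(** * Star vertices *)

(* For the vertex at which the edges form a star, this is all of the star
   structure that matters. *)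
Definition star_like (H : hypergraph) (v : H) : Prop :=
  forall e e' : {set H}, e \in edges H -> e' \in edges H -> v \in e -> v \in e' ->
  e != e' -> e :&: e' = [set v].

(** Distinct edges of a star share only [None], and injectivity of the isomorphism carries this back
    to [H]. *)
Lemma star_vertex_star_like k (H : hypergraph) (v : H) :
  star_vertex k v -> star_like H v.
Proof.
move=> [d [f bijf fE]] e e' eH e'H ve ve' nee'.
set F := [set e in edges H | v \in e] in f bijf fE.
have eF : e \in F by rewrite inE eH.
have e'F : e' \in F by rewrite inE e'H.
have injf := bij_inj bijf.
pose lift (a : {set H}) : {set induced F} := [set x | val x \in a].
have liftK a : a \in F -> [set val x | x in lift a] = a.
  move=> aF; apply/setP=> x; apply/imsetP/idP=> [[y]|xa].
    by rewrite inE => ya ->.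
  have xc : x \in cover F by apply/bigcupP; exists a.
  by exists (exist _ x xc); rewrite ?inE.
have starE a : a \in F -> exists i : 'I_d,
    f @: lift a = None |: [set Some (i, j) | j in [set: 'I_k.-1]].
  move=> aF; have : f @: lift a \in edges (star k d).
    by rewrite fE inE liftK.
  by case/imsetP=> i _ ->; exists i.
have [i fi] := starE e eF; have [i' fi'] := starE e' e'F.
have nii' : i != i'.
  apply: contraNneq nee' => ii'; rewrite -(liftK e) // -(liftK e') //.
  suff -> : lift e = lift e' by [].
  by apply: (imset_inj injf); rewrite fi fi' ii'.
have fNone (x : induced F) : val x \in e -> val x \in e' -> f x = None.
  move=> xe xe'.
  have : f x \in f @: lift e by rewrite imset_f ?inE.
  have : f x \in f @: lift e' by rewrite imset_f ?inE.
  rewrite fi fi' !inE; case: (f x) => //= -[a b] /imsetP[j _ [-> _]] /imsetP[j' _ [E _]].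
  by rewrite E eqxx in nii'.
have cov x : x \in e -> x \in cover F by move=> xe; apply/bigcupP; exists e.
apply/setP=> x; rewrite !inE; apply/andP/eqP=> [[xe xe']|->//].
have := fNone (exist _ x (cov x xe)) xe xe'.
by rewrite -(fNone (exist _ v (cov v ve)) ve ve') => /injf [].
Qed.

(** * Monochromatic copies and absorption of a vertex *)

Definition mono_copy {V : finType} (c : {set V} -> bool) (b : bool)
    {G : hypergraph} (f : G -> V) : Prop :=
  injective f /\ {in edges G, forall e : {set G}, c (f @: e) = b}.

Lemma homogeneous_mono_copy {V : finType} k (c : {set V} -> bool) b (G : hypergraph)
    (B : {set V}) :
  uniform k G -> #|G| <= #|B| -> homogeneous k c b B ->
  exists2 f : G -> V, mono_copy c b f & forall x, f x \in B.
Proof.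
move=> uG le hB.
(* [V] may be empty, so there is no constant function to start from; numbering [G] and [B] provides
   an initial function. *)
have [|g [injg gB _]] := redefine_injectively
  (fun x : 'I_#|G| => enum_val (widen_ord le x)) setT B.
  by rewrite cardsT card_ord.
have gB' x : g (enum_rank x) \in B by apply: gB.
exists (fun x => g (enum_rank x)) => //.
have inj : injective (fun x => g (enum_rank x)).
  by move=> x y /injg-/(_ (in_setT _) (in_setT _))/enum_rank_inj.
split=> // e eG; apply: hB; last by rewrite card_imset // uG.
by apply/subsetP=> _ /imsetP[x _ ->].
Qed.

(** The edges at [v0], with [v0] removed, are disjoint [k]-sets. If they embed in [Q] as sets that
    [v] completes to colour [b], the other vertices of [H] go anywhere in the rest of [Q]: an edge
    avoiding [v0] gets colour [b] by homogeneity. *)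
Lemma star_like_absorb {V : finType} k (c : {set V} -> bool) b (H : hypergraph)
    (v0 : H) (Q : {set V}) (v : V) :
  uniform k.+1 H -> star_like H v0 -> v \notin Q -> #|H| <= #|Q| ->
  homogeneous k.+1 c b Q ->
  (exists f : H -> V, [/\ mono_copy c b f, f v0 = v & forall x, x != v0 -> f x \in Q]) \/
  (exists2 Q' : {set V}, Q' \subset Q /\ #|Q| <= #|Q'| + #|H| &
    homogeneous k (fun e => c (v |: e)) (~~ b) Q').
Proof.
move=> uH starv vQ leHQ hQ.
pose E := enum [set e in edges H | v0 \in e].
have EP e : (e \in E) = (e \in edges H) && (v0 \in e) by rewrite mem_enum inE.
pose s := [seq e :\ v0 | e : {set H} <- E].
have cs : {in s, forall a : {set H}, #|a| = k}.
  move=> _ /mapP[e + ->]; rewrite EP => /andP[eH ve].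
  by have := cardsD1 v0 e; rewrite ve uH // => -[].
have ds : pairwise (fun a a' : {set H} => [disjoint a & a']) s.
  rewrite pairwise_map.
  have : pairwise [rel x y | x != y] E by rewrite -uniq_pairwise enum_uniq.
  apply: (@sub_in_pairwise _ [in E]); last by apply/allP.
  move=> e e'; rewrite !EP => /andP[eH ve] /andP[e'H ve'] /= ne.
  rewrite -setI_eq0; apply/eqP/setP=> x; rewrite !inE.
  have /setP/(_ x) := starv e e' eH e'H ve ve' ne; rewrite !inE.
  by case: (x == v0) => //= ->.
have [[f [injf fQ fc]]|] := disjoint_family_embedding k (fun e => c (v |: e)) b Q
  (fun _ => v) s cs ds; last by right.
left; set X := \bigcup_(a <- s) a in injf fQ.
have vX : v0 \notin X.
  rewrite /X big_tnth; apply/bigcupP => -[i _].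
  by have /mapP[e _ ->] := mem_tnth i (in_tuple s); rewrite !inE eqxx.
have eX e x : e \in edges H -> v0 \in e -> x \in e -> x != v0 -> x \in X.
  move=> eH ve xe xv; rewrite /X (big_rem (e :\ v0)) /=; last first.
    by apply: map_f; rewrite EP eH.
  by rewrite !inE xv xe.
have [|g [injg gQ gf]] := redefine_injectively (fun x => if x == v0 then v else f x)
   (~: (v0 |: X)) (Q :\: f @: X).
  have := cardsC (v0 |: X); rewrite cardsU1 vX.
  have := cardsID (f @: X) Q; have := subset_leq_card (subsetIr Q (f @: X)).
  rewrite card_in_imset //; lia.
have gv : g v0 = v by rewrite gf ?eqxx // !inE eqxx.
have gX x : x \in X -> g x = f x.
  move=> xX; rewrite gf; last by rewrite !inE xX orbT.
  by rewrite (negPf (memPn vX x xX)).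
have gQX x : x != v0 -> x \notin X -> g x \in Q :\: f @: X.
  by move=> xv xX; apply: gQ; rewrite !inE negb_or xv.
have gQ' x : x != v0 -> g x \in Q.
  move=> xv; have [xX|xX] := boolP (x \in X); first by rewrite gX ?fQ.
  by have := gQX x xv xX; rewrite inE => /andP[].
have inj : injective g.
  move=> x y Exy; have [xv|xv] := eqVneq x v0; have [yv|yv] := eqVneq y v0.
  - by rewrite xv yv.
  - by have := gQ' y yv; rewrite -Exy xv gv (negPf vQ).
  - by have := gQ' x xv; rewrite Exy yv gv (negPf vQ).
  have [xX|xX] := boolP (x \in X); have [yX|yX] := boolP (y \in X).
  - by apply: injf => //; rewrite -!gX.
  - by have := gQX y yv yX; rewrite -Exy gX // inE imset_f.
  - by have := gQX x xv xX; rewrite Exy gX // inE imset_f.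
  - by apply: injg; rewrite // !inE negb_or ?xv ?yv.
exists g; split=> //; split=> // e eH; have [ve|ve] := boolP (v0 \in e).
  rewrite -{1}(setD1K ve) imsetU1 gv -(fc (e :\ v0)); last first.
    by apply: map_f; rewrite EP eH.
  congr (c (_ |: _)); apply: eq_in_imset => x; rewrite !inE => /andP[xv xe].
  exact/gX/(eX e).
apply: hQ; last by rewrite card_imset // uH.
by apply/subsetP=> _ /imsetP[x xe ->]; apply: gQ'; apply: contraNneq ve => <-.
Qed.

(** Sending [S] into [Q] and its complement into [T] turns every edge of [G] into one vertex [v] of
    [T] plus a [k]-set of [Q], whose colour the link of [v] determines. *)
Lemma strong_independent_mono_copy {V : finType} k (c : {set V} -> bool) b
    (G : hypergraph) (S : {set G}) (T Q : {set V}) :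
  uniform k.+1 G -> strong_independent S -> [disjoint T & Q] ->
  #|~: S| <= #|T| -> #|S| <= #|Q| ->
  {in T, forall v, homogeneous k (fun e => c (v |: e)) b Q} ->
  exists f : G -> V, mono_copy c b f.
Proof.
move=> uG /andP[_ /forall_inP strS] dTQ leT leQ hTQ.
(* Without vertices, [G] has no edge either, as edges have size [k.+1]; [V] may then be empty. *)
have [x0|G0] := pickP G; last first.
  have nil (x : G) : False by have := G0 x.
  exists (fun x => match nil x with end); split=> [x|]; first by case: (nil x).
  by move=> e /uG; have [->|[x]] := set_0Vmem e; [rewrite cards0|case: (nil x)].
move=> _; have /card_gt0P[y0 _] : 0 < #|V|.
  have : 0 < #|G| by apply/card_gt0P; exists x0.
  have lT : #|T| <= #|V| := max_card _; have lQ : #|Q| <= #|V| := max_card _.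
  by rewrite -(cardsC S); lia.
have [f [injf fQ _]] := redefine_injectively (fun=> y0) S Q leQ.
have [g [injg gT gf]] := redefine_injectively f (~: S) T leT.
have gS x : x \in S -> g x \in Q.
  by move=> xS; rewrite gf ?inE ?xS // fQ.
have gnS x : x \notin S -> g x \in T by move=> xS; apply: gT; rewrite inE.
have TQ x : x \in T -> x \in Q -> False.
  by move=> xT xQ; have /pred0P/(_ x) := dTQ; rewrite /= xT xQ.
have inj : injective g.
  move=> x y Exy; have [xS|xS] := boolP (x \in S); have [yS|yS] := boolP (y \in S).
  - by apply: injf => //; rewrite -!gf ?inE ?xS ?yS.
  - by case: (TQ (g y)); [apply: gnS|rewrite -Exy gS].
  - by case: (TQ (g x)); [apply: gnS|rewrite Exy gS].
  - by apply: injg => //; rewrite inE.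
exists g; split=> // e eG; have /cards1P[u eu] := strS e eG.
have /setDP[ue uS] : u \in e :\: S by rewrite eu set11.
have eS x : x \in e :\ u -> x \in S.
  rewrite !inE => /andP[xu xe]; apply: contraNT xu => xS.
  by rewrite -in_set1 -eu inE xS.
rewrite -(setD1K ue) imsetU1; apply: (hTQ _ (gnS u uS)).
  by apply/subsetP=> _ /imsetP[x xe ->]; apply/gS/eS.
by rewrite card_imset //; have := cardsD1 u e; rewrite ue uG // => -[].
Qed.

(** [T] collects vertices of [L] that yield no blue [H]; each costs [Q'] at most [#|H|] vertices and
    has a red link on what remains. Once [#|T| = #|~: S|], the [#|S|] vertices surely left in [Q']
    complete a red [G]; until then, the last summand [#|H|] leaves room for trying another
    vertex. *)
Lemma absorb_one {V : finType} k (c : {set V} -> bool) (G H : hypergraph)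
    (S : {set G}) (v0 : H) (L Q : {set V}) :
  uniform k.+1 G -> strong_independent S -> uniform k.+1 H -> star_like H v0 ->
  [disjoint L & Q] -> #|~: S| <= #|L| ->
  #|~: S| * #|H| + #|S| + #|H| <= #|Q| -> homogeneous k.+1 c false Q ->
  (exists f : G -> V, mono_copy c true f) \/
  (exists f : H -> V, [/\ mono_copy c false f, f v0 \in L &
     forall x, x != v0 -> f x \in Q]).
Proof.
move=> uG strS uH starv dLQ leL leQ hQ.
suff grow m : m <= #|~: S| ->
    (exists f : H -> V, [/\ mono_copy c false f, f v0 \in L &
       forall x, x != v0 -> f x \in Q]) \/
    exists T Q' : {set V}, [/\ T \subset L, #|T| = m, Q' \subset Q,
      #|Q| <= #|Q'| + m * #|H| &
      {in T, forall v, homogeneous k (fun e => c (v |: e)) true Q'}].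
  have [|[T [Q' [sTL cT sQ cQ hT]]]] := grow #|~: S| (leqnn _); first by right.
  left; apply: (strong_independent_mono_copy k c true G S T Q') => //.
  - by apply: disjointWl sTL _; apply: disjointWr sQ _.
  - by rewrite cT.
  - lia.
elim: m => [|m IH] lem.
  right; exists set0, Q; rewrite sub0set cards0 subxx; split=> //; first by lia.
  by move=> v; rewrite inE.
have [|[T [Q' [sTL cT sQ cQ hT]]]] := IH (ltnW lem); first by left.
have /card_gt0P[v /setDP[vL vT]] : 0 < #|L :\: T|.
  by rewrite cardsD (setIidPr sTL) cT subn_gt0 (leq_trans lem).
have vQ : v \notin Q by rewrite (disjointFr dLQ vL).
have leH : #|H| <= #|Q'| by nia.
have [[f [cf fv fQ]]|[Q'' [sQ'' cQ''] hQ'']] := star_like_absorb k c false H v0 Q' v uH starv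
  (contra (subsetP sQ v) vQ) leH (homogeneousS _ _ _ _ _ sQ hQ).
  left; exists f; split=> //; first by rewrite fv.
  by move=> x /fQ; apply: (subsetP sQ).
right; exists (v |: T), Q''; split.
- by rewrite subUset sub1set vL.
- by rewrite cardsU1 vT cT.
- exact: subset_trans sQ'' sQ.
- by rewrite mulSn; lia.
- move=> w; rewrite inE => /orP[/set1P->//|wT].
  exact: homogeneousS sQ'' (hT w wT).
Qed.

(** * Packing disjoint blue copies *)

(** Disjointness is encoded by deleting each copy before the next is chosen, which suits arguments
    that find one copy at a time. *)
Fixpoint packs {V : finType} (c : {set V} -> bool) (H : hypergraph) (n : nat)
    (U : {set V}) : Prop :=
  if n is m.+1 then
    exists f : H -> V, [/\ mono_copy c false f, forall x, f x \in U &
      packs c H m (U :\: f @: setT)]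
  else True.

Lemma packsS {V : finType} (c : {set V} -> bool) (H : hypergraph) n (U U' : {set V}) :
  U \subset U' -> packs c H n U -> packs c H n U'.
Proof.
elim: n U U' => //= n IH U U' sUU' [f [cf fU pf]]; exists f; split=> //.
  by move=> x; apply: (subsetP sUU').
by apply: IH pf; apply: setSD.
Qed.

Lemma packs_copies {V : finType} (c : {set V} -> bool) (H : hypergraph) n (U : {set V}) :
  packs c H n U -> exists2 F : 'I_n * H -> V, injective F &
    (forall p, F p \in U) /\
    forall i (e : {set H}), e \in edges H -> c [set F (i, x) | x in e] = false.
Proof.
elim: n U => [|n IH] U.
  have F0 (p : 'I_0 * H) : V by case: p => -[].
  by exists F0 => [[[]]//|]; split=> [[[]]|[]].
case=> f [[injf cf] fU /IH [F injF [FU cF]]].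
pose F' (p : 'I_n.+1 * H) := if unlift ord0 p.1 is Some i then F (i, p.2) else f p.2.
have Ff i x y : F (i, x) = f y -> False.
  by move=> E; have := FU (i, x); rewrite E inE imset_f.
exists F'; last split.
- move=> [i x] [j y]; rewrite /F' /=.
  case: unliftP => [i' ->|->]; case: unliftP => [j' ->|->].
  + by move/injF => [-> ->].
  + by move/Ff.
  + by move/esym/Ff.
  + by move/injf => ->.
- move=> [i x]; rewrite /F' /=; case: unliftP => [i' _|_] //.
  by have := FU (i', x); rewrite inE => /andP[].
- move=> i e eH; rewrite /F' /=.
  by case: unliftP => [i' _|_]; [apply: cF|apply: cf].
Qed.

Lemma packs_homogeneous {V : finType} k (c : {set V} -> bool) (H : hypergraph) n
    (Q : {set V}) :
  uniform k H -> n * #|H| <= #|Q| -> homogeneous k c false Q -> packs c H n Q.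
Proof.
move=> uH; elim: n Q => // n IH Q; rewrite mulSn => leQ hQ.
have [|f cf fQ] := homogeneous_mono_copy k c false H Q uH _ hQ; first by lia.
exists f; split=> //; apply: IH (homogeneousS _ _ _ _ _ (subsetDl _ _) hQ).
have := cardsID (f @: setT) Q; have := subset_leq_card (subsetIr Q (f @: setT)).
have := leq_imset_card f setT; rewrite cardsT; lia.
Qed.

(** Each blue copy takes one vertex of [L] and [#|H| - 1] of [Q]. The first size condition survives
    because its sides drop by [#|H|] and [#|H| - 1], the second because [#|L| + #|Q|] drops by
    exactly [#|H|]. *)
Lemma packs_absorb {V : finType} k (c : {set V} -> bool) (G H : hypergraph)
    (S : {set G}) (v0 : H) n (L Q : {set V}) :
  uniform k.+1 G -> strong_independent S -> uniform k.+1 H -> star_like H v0 ->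
  [disjoint L & Q] -> homogeneous k.+1 c false Q ->
  #|L| * #|H| + #|~: S| * #|H| + #|S| + #|H| <= #|Q| ->
  n * #|H| + #|~: S| <= #|L| + #|Q| + 1 ->
  (exists f : G -> V, mono_copy c true f) \/ packs c H n (L :|: Q).
Proof.
move=> uG strS uH starv; elim: n L Q => [|n IH] L Q dLQ hQ leQ; [by right|rewrite mulSn => leN].
have [ltL|leL] := ltnP #|L| #|~: S|.
  (* Now [#|L| + 1 <= #|~: S|], so [leN] gives [n.+1 * #|H| <= #|Q|] and [L] can be discarded. *)
  right; apply: packsS (subsetUr _ _) _.
  by apply: packs_homogeneous uH _ hQ; lia.
have [||[f [cf fL fQ]]] := absorb_one k c G H S v0 L Q uG strS uH starv dLQ leL _ hQ.
- by lia.
- by left.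
have fim : f @: setT = f v0 |: f @: (setT :\ v0) by rewrite -imsetU1 setD1K.
have fsub : f @: (setT :\ v0) \subset Q.
  by apply/subsetP=> _ /imsetP[x + ->]; rewrite !inE andbT; apply: fQ.
have cfim : #|f @: (setT :\ v0)| = #|H|.-1.
  by rewrite card_imset; [rewrite cardsDS ?sub1set // cardsT cards1 subn1|case: cf].
have H0 : 0 < #|H| by apply/card_gt0P; exists v0.
have cL := cardsD1 (f v0) L; rewrite fL in cL.
have cQ : #|Q :\: f @: (setT :\ v0)| = #|Q| - #|H|.-1 by rewrite cardsDS // cfim.
have [||||?|pk] := IH (L :\ f v0) (Q :\: f @: (setT :\ v0)).
- by apply: disjointWl (subsetDl _ _) _; apply: disjointWr (subsetDl _ _) _.
- exact: homogeneousS (subsetDl _ _) hQ.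
- rewrite cQ; nia.
- rewrite cQ; nia.
- by left.
right; exists f; split=> //.
  move=> x; rewrite inE; have [->|/fQ->] := eqVneq x v0; first by rewrite fL.
  by rewrite orbT.
apply: packsS pk; rewrite fim; apply/subsetP=> x; rewrite !inE negb_or.
have fvQ : f v0 \notin Q by rewrite (disjointFr dLQ fL).
case/orP=> /andP[h1 h2].
  rewrite h1 h2 /= andbT; apply: contraFN (disjointFr dLQ h2); exact: (subsetP fsub).
by rewrite h1 h2 orbT !andbT; apply: contraNneq fvQ => <-.
Qed.

(** Removing copies inside [L] leaves [Q] intact, so [Q] need only be large in terms of [r], not of
    [n]; once [#|L| <= r], absorption takes over. *)
Lemma packs_large {V : finType} k (c : {set V} -> bool) (G H : hypergraph)
    (S : {set G}) (v0 : H) r n (L Q : {set V}) :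
  uniform k.+1 G -> strong_independent S -> uniform k.+1 H -> star_like H v0 ->
  (forall U : {set V}, r <= #|U| -> (exists f : G -> V, mono_copy c true f) \/
     exists2 f : H -> V, mono_copy c false f & forall x, f x \in U) ->
  [disjoint L & Q] -> homogeneous k.+1 c false Q ->
  r * #|H| + #|~: S| * #|H| + #|S| + #|H| <= #|Q| ->
  n * #|H| + #|~: S| <= #|L| + #|Q| + 1 ->
  (exists f : G -> V, mono_copy c true f) \/ packs c H n (L :|: Q).
Proof.
move=> uG strS uH starv blue; elim: n L => [|n IH] L dLQ hQ leQ; [by right|rewrite mulSn => leN].
have [leL|ltL] := leqP #|L| r.
  by apply: (packs_absorb k c G H S v0) => //; nia.
have [|[f cf fL]] := blue L (ltnW ltL); first by left.
have sfL : f @: setT \subset L by apply/subsetP=> _ /imsetP[x _ ->].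
have cL : #|L :\: f @: setT| = #|L| - #|H|.
  by rewrite cardsDS // card_imset ?cardsT //; case: cf.
have [||||?|pk] := IH (L :\: f @: setT).
- by apply: disjointWl (subsetDl _ _) _.
- by [].
- by [].
- by rewrite cL; lia.
- by left.
right; exists f; split=> // [x|]; first by rewrite inE fL.
apply: packsS pk; apply/subsetP=> x; rewrite !inE => /orP[/andP[-> ->]//|xQ].
rewrite xQ orbT andbT; apply: contraTN xQ => /(subsetP sfL) xL.
by rewrite (disjointFr dLQ xL).
Qed.

(** * The upper bound *)

Lemma mono_copy_contains k N (c : {set 'I_N} -> bool) b (G : hypergraph) (f : G -> 'I_N) :
  uniform k G -> mono_copy c b f -> contains (monochromatic k c b) G.
Proof.
move=> uG [injf cf]; exists f => // e eG.
by rewrite inE card_imset // uG // cf // !eqxx.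
Qed.

Lemma arrows_copies k (G H : hypergraph) (S : {set G}) (v0 : H) :
  uniform k.+1 G -> strong_independent S -> uniform k.+1 H -> star_like H v0 ->
  exists n0, forall n N, n0 <= N -> n * #|H| + #|~: S| <= N + 1 ->
    arrows k.+1 N G (copies n H).
Proof.
move=> uG strS uH starv.
have [r Hr] := ramsey k.+1 #|G| #|H|.
(* [n0] does not involve [n]: the blue clique needs only the fixed size required by [packs_large],
   and a red clique on [#|G|] vertices already contains [G]. *)
have [n0 Hn0] := ramsey k.+1 #|G| (r * #|H| + #|~: S| * #|H| + #|S| + #|H|).
exists n0 => n N le0 leN c.
have red (B : {set 'I_N}) : #|B| = #|G| -> homogeneous k.+1 c true B ->
    exists f : G -> 'I_N, mono_copy c true f.
  move=> cB hB; have [|f cf _] := homogeneous_mono_copy _ _ _ G B uG _ hB.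
    by rewrite cB.
  by exists f.
have blue (U : {set 'I_N}) : r <= #|U| -> (exists f : G -> 'I_N, mono_copy c true f) \/
    exists2 f : H -> 'I_N, mono_copy c false f & forall x, f x \in U.
  move=> /Hr-/(_ c)[[B [_ cB] hB]|[B [sBU cB] hB]]; first by left; apply: red hB.
  right; have [|f cf fB] := homogeneous_mono_copy _ _ _ H B uH _ hB; first by rewrite cB.
  by exists f => // x; apply: (subsetP sBU).
have [|[B [_ cB] hB]|[Q [_ cQ] hQ]] := Hn0 _ [set: 'I_N] c.
- by rewrite cardsT card_ord.
- by left; have [f cf] := red B cB hB; apply: mono_copy_contains cf.
have [|||[f cf]|pk] := packs_large k c G H S v0 r n (~: Q) Q uG strS uH starv blue _ hQ.
- by rewrite disjoint_sym -setI_eq0 setICr.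
- by rewrite cQ.
- by rewrite addnC in leN; have := cardsC Q; rewrite card_ord; lia.
- by left; apply: mono_copy_contains cf.
right; have [F injF [_ cF]] := packs_copies c H n _ pk.
exists F => // _ /imset2P[i e _ eH ->].
rewrite inE card_imset // card_imset ?uH // ?eqxx /=; last by move=> x y [].
by rewrite -imset_comp; apply/eqP/cF.
Qed.

(** * The lower bound *)

Lemma not_arrows_copies k (G H : hypergraph) n M :
  no_isolated_vertex H -> alpha G < #|G| -> 0 < n * #|H| ->
  M < #|G| + n * #|H| - alpha G - 1 ->
  ~ arrows k M G (copies n H).
Proof.
move=> isolH ltG nH0 ltM.
(* [A], which carries the blue edges, is one vertex short of [copies n H]; if [M] is smaller still,
   [A] is the whole vertex set. *)
have [|A _ cA] := exists_subset_card [set: 'I_M] (minn M (n * #|H|).-1).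
  by rewrite cardsT card_ord geq_minl.
case/(_ (fun e => ~~ (e \subset A))) => [[f injf fE]|[f injf fE]].
  have indep : independent (f @^-1: A).
    apply/forall_inP=> e /fE; rewrite inE => /andP[_ /eqP]; apply: contraTN.
    by rewrite -sub_imset_pre => ->.
  have leI : #|f @^-1: A| <= alpha G.
    exact: (@leq_bigmax_cond _ _ (fun S : {set G} => #|S|)).
  have : #|~: (f @^-1: A)| <= #|~: A|.
    rewrite -(card_imset _ injf); apply/subset_leq_card/subsetP=> _ /imsetP[x + ->].
    by rewrite !inE.
  by have := cardsC A; have := cardsC (f @^-1: A); rewrite card_ord; lia.
(* Every vertex of the copies lies in an edge and blue edges lie in [A], so all [n * #|H|] vertices
   would have to fit in [A]. *)
have fA p : f p \in A.
  case: p => i x; have [e eH xe] := isolH x.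
  have /fE : [set (i, y) | y in e] \in edges (copies n H).
    by apply/imset2P; exists i e.
  rewrite inE => /andP[_ /eqP/negbFE/subsetP]; apply.
  by apply/imset_f/imset_f.
have : #|f @: setT| <= #|A| by apply/subset_leq_card/subsetP=> _ /imsetP[x _ ->].
by rewrite card_imset // cardsT card_prod card_ord cA; lia.
Qed.

(** * The Ramsey number for large [n] *)

Theorem theorem2p7 (k : nat) (G H : hypergraph)
    (goodG : good k G) (edgesG : edges G != set0)
    (unifH : uniform k H) (isolH : no_isolated_vertex H)
    (starH : exists v : H, star_vertex k v) :
  exists n0 : nat, forall n : nat, n0 <= n ->
    is_ramsey_number k G (copies n H) (#|G| + n * #|H| - alpha G - 1).
Proof.
case: goodG => uG [S0 strS0] starE.
have [S strS cS] : exists2 S : {set G}, strong_independent S & #|S| = alpha G.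
  rewrite -starE /alpha_star (bigop.bigmax_eq_arg S0) //.
  by case: arg_maxnP => // S strS _; exists S.
have [v0 /star_vertex_star_like starv] := starH.
have [e eG] := set0Pn _ edgesG.
have /andP[_ /forall_inP/(_ e eG)/eqP ceS] := strS.
(* For [k = 0] the edge [e] would be empty, but it has a vertex outside [S]. *)
case: k => [|k] in uG unifH starH *.
  by move: (subset_leq_card (subsetDl e S)); rewrite ceS uG.
have cCS : #|G| = alpha G + #|~: S| by rewrite -cS cardsC.
have CS0 : 0 < #|~: S|.
  by rewrite -ceS; apply/subset_leq_card/subsetP=> x; rewrite !inE => /andP[].
have H0 : 0 < #|H| by apply/card_gt0P; exists v0.
have [n0 Hn0] := arrows_copies k G H S v0 uG strS unifH starv.
(* The claimed value is [n * #|H| + #|~: S| - 1], which is at least [n]; the successor makes [n],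
   hence this value, positive. *)
exists n0.+1 => n lt0; have nH : n <= n * #|H| by rewrite leq_pmulr.
split; [by lia| |].
  by apply: Hn0; lia.
move=> M _ arrM; rewrite leqNgt; apply/negP=> ltM.
by apply: (not_arrows_copies (k.+1) G H n M) arrM => //; lia.
Qed.
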